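(* Let $\xi<\omega_1$, let $K$ be homeomorphic to the ordinal interval $[1,\omega^\xi]$, and let $(f_i)$ be a normalized weakly null sequence in $C(K)$. Let $\mathcal{F}$ be a regular family of order $\xi$, and assume that $(f_i)$ is $\mathcal{F}$-unconditional. Then $(f_i)$ has an unconditional subsequence.
   Context: Families of finite subsets of $\mathbb{N}$: $\mathcal{F}$ is hereditary if $G\subset F\in\mathcal{F}$ implies $G\in\mathcal{F}$; spreading if $\{m_1<\dots<m_k\}\in\mathcal{F}$, $n_1<\dots<n_k$ and $m_i\le n_i$ for all $i\le k$ imply $\{n_1,\dots,n_k\}\in\mathcal{F}$; compact if it is compact in the topology of pointwise convergence (identifying sets with their indicator functions in $\{0,1\}^{\mathbb{N}}$). $\mathcal{F}$ is regular if it is hereditary, spreading, compact and contains all singletons. A regular family $\mathcal{F}$ is of order $\xi$ if its $\xi$-th Cantor–Bendixson derivative satisfies $\mathcal{F}^{(\xi)}=\{\emptyset\}$. For a hereditary family $\mathcal{F}$ of finite subsets of $\mathbb{N}$ containing the singletons, a normalized (Schauder) basic sequence $(x_n)$ in a Banach space is $\mathcal{F}$-unconditional if there is a constant $C>0$ such that $\|\sum_{n\in F}a_nx_n\|\le C\|\sum_n a_nx_n\|$ for every $F\in\mathcal{F}$ and every finitely supported scalar sequence $(a_n)$. *)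

(* Defs.v *)
From HB Require Import structures.
From mathcomp Require Import all_boot all_order all_algebra finmap ring lra.
From mathcomp Require Import all_classical all_reals all_analysis.

Set Implicit Arguments.
Unset Strict Implicit.
Unset Printing Implicit Defensive.

Import Order.TTheory GRing.Theory Num.Theory.
Import numFieldNormedType.Exports.

Local Open Scope classical_set_scope.
Local Open Scope ring_scope.

(** * Ordinals *)

(* An ordinal xi is given by a well-ordered type X of order type xi; the
   elements of X are then the ordinals below xi, and xi < omega_1 means that X
   is countable. *)
Definition wellorder d (X : orderType d) : Prop :=
  well_founded (fun x y : X => (x < y)%O).

(* The ordinal omega ^ xi: f stands for the Cantor normal form
   \sum_x omega ^ x * f x, summed along decreasing x, so two elements are
   compared at the largest exponent at which they differ. *)
Definition omega_pow d (X : orderType d) : Type :=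
  {fsfun X -> nat with 0%N}.

Section omega_pow_order.
Context d (X : orderType d).
Local Notation W := (omega_pow X).

HB.instance Definition _ := Choice.on W.

Definition omega_pow0 : W := [fsfun].

Definition omega_pow_lt : rel W := fun f g =>
  `[< exists x, (f x < g x)%N /\ forall y, (x < y)%O -> f y = g y >].

Let lt_irr : irreflexive omega_pow_lt.
Proof. by move=> f; apply/asboolP => -[x []]; rewrite ltnn. Qed.

Let lt_trans : transitive omega_pow_lt.
Proof.
move=> g f h /asboolP[x [fgx fgy]] /asboolP[y [ghy ghz]]; apply/asboolP.
have [xy|yx|exy] := ltgtP x y.
- exists y; split; first by rewrite fgy.
  by move=> z yz; rewrite fgy ?ghz // (lt_trans xy).
- exists x; split; first by rewrite -ghz.
  by move=> z xz; rewrite fgy ?ghz // (lt_trans yx).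
- subst y; exists x; split; first exact: ltn_trans ghy.
  by move=> z xz; rewrite fgy ?ghz.
Qed.

Lemma omega_pow_max_diff (f g : W) : f != g ->
  exists x, f x != g x /\ forall y, (x < y)%O -> f y = g y.
Proof.
move=> fg.
pose D := [fset x in (finsupp f `|` finsupp g)%fset | f x != g x]%fset.
have inD x : (x \in D) = (f x != g x).
  rewrite !inE /= !mem_finsupp.
  by case: (f x =P 0%N) => [->|//]; case: (g x =P 0%N) => [->|//].
have [x0 x0D] : exists x, x \in D.
  apply: contra_neqP fg => /forallNP D0; apply/fsfunP => x.
  by apply/eqP/negPn; rewrite -inD; apply/negP.
case: (@Order.TotalTheory.arg_maxP d X D [` x0D]%fset xpredT val) => //= x _ xmax.
exists (val x); split; first by rewrite -inD (valP x).
move=> y xy; apply/eqP/negPn; rewrite -inD; apply/negP => yD.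
by have := xmax [` yD]%fset isT; rewrite /= leNgt xy.
Qed.

Let lt_total f g : f != g -> omega_pow_lt f g || omega_pow_lt g f.
Proof.
move=> /omega_pow_max_diff[x [fgx fgy]]; apply/orP.
move: fgx; rewrite neq_ltn => /orP[fgx|gfx]; [left|right]; apply/asboolP.
  by exists x.
by exists x; split => // y /fgy.
Qed.

HB.instance Definition _ := @Order.LtOrder.Build d W
  (fun f g => (f == g) || omega_pow_lt f g) omega_pow_lt
  (fun f g => if omega_pow_lt f g then f else g)
  (fun f g => if omega_pow_lt f g then g else f)
  (fun _ _ => erefl) (fun _ _ => erefl) (fun _ _ => erefl)
  lt_irr lt_trans lt_total.

Lemma omega_pow_ltP (f g : W) :
  reflect (exists x, (f x < g x)%N /\ forall y, (x < y)%O -> f y = g y)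
          (f < g)%O.
Proof. exact: asboolP. Qed.

Lemma omega_pow_eq0 (f : W) : ~ (f < omega_pow0)%O.
Proof. by move/omega_pow_ltP => [x []]; rewrite fsfunE. Qed.

Lemma omega_pow_wf : wellorder X -> wellorder W.
Proof.
move=> wfX.
pose lt := fun f g : W => (f < g)%O.
suff Q x : forall h : W, (forall z, (x < z)%O -> h z = 0%N) -> Acc lt h.
  move=> f; have [->|] := eqVneq f omega_pow0.
    by constructor => g /omega_pow_eq0.
  move=> /omega_pow_max_diff[x [_ fx]]; apply: (Q x) => z /fx ->.
  by rewrite fsfunE.
elim/(well_founded_ind wfX): x => x IHx h.
have [n] : exists n, (h x < n)%N by exists (h x).+1.
elim: n h => [h|n IHn h hxn hx0]; first by rewrite ltn0.
pose low (k : W) : W := [fsfun y in finsupp k => if (y < x)%O then k y else 0%N].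
have lowE k y : low k y = if (y < x)%O then k y else 0%N.
  rewrite fsfunE; case: ifP => // /negbT; rewrite memNfinsupp => /eqP ->.
  by case: ifP.
have lowAcc k : Acc lt (low k).
  have [->|] := eqVneq (low k) omega_pow0.
    by constructor => g /omega_pow_eq0.
  move=> /omega_pow_max_diff[y [ky0 kz]]; apply: (IHx y).
    by move: ky0; rewrite lowE; case: ifP => //; rewrite fsfunE.
  by move=> z /kz ->; rewrite fsfunE.
move: (lowAcc h); move El : (low h) => l Al.
elim: Al h hxn hx0 El => {}l _ IHl h hxn hx0 El.
constructor => g /omega_pow_ltP[y [ghy ghz]].
have yx : (y <= x)%O.
  by rewrite leNgt; apply/negP => /hx0 h0; move: ghy; rewrite h0.
have gx0 z : (x < z)%O -> g z = 0%N.
  by move=> xz; rewrite ghz ?hx0 // (le_lt_trans yx).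
move: yx; rewrite le_eqVlt => /orP[/eqP yx|yx].
  by subst y; apply: IHn => //; exact: leq_trans ghy _.
apply: (IHl (low g)) => //; last by rewrite ghz.
rewrite -El; apply/omega_pow_ltP; exists y; split; first by rewrite !lowE yx.
by move=> z yz; rewrite !lowE ghz.
Qed.

End omega_pow_order.

(* The successor ordinal alpha + 1, with None as greatest element. *)
Definition ord_succ (A : Type) : Type := option A.

Section ord_succ_order.
Context d (A : orderType d).
Local Notation S := (ord_succ A).

HB.instance Definition _ := Choice.on S.

Definition ord_succ_lt : rel S := fun u v =>
  match u, v with
  | Some a, Some b => (a < b)%O
  | Some _, None => true
  | None, _ => false
  end.

Let lt_irr : irreflexive ord_succ_lt.
Proof. by case=> //= a; rewrite ltxx. Qed.

Let lt_trans : transitive ord_succ_lt.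
Proof. by case=> [b|] [a|] [c|] //=; exact: lt_trans. Qed.

Let lt_total u v : u != v -> ord_succ_lt u v || ord_succ_lt v u.
Proof. by case: u v => [a|] [b|] //= ab; rewrite -neq_lt. Qed.

HB.instance Definition _ := @Order.LtOrder.Build d S
  (fun f g => (f == g) || ord_succ_lt f g) ord_succ_lt
  (fun f g => if ord_succ_lt f g then f else g)
  (fun f g => if ord_succ_lt f g then g else f)
  (fun _ _ => erefl) (fun _ _ => erefl) (fun _ _ => erefl)
  lt_irr lt_trans lt_total.

Lemma ord_succ_wf : wellorder A -> wellorder S.
Proof.
move=> wfA; pose lt := fun u v : S => (u < v)%O.
have AccS (a : A) : Acc lt (Some a).
  elim/(well_founded_ind wfA): a => a IH.
  by constructor => -[b|] ba; [exact: IH | case: (notF ba)].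
move=> [a|]; first exact: AccS.
by constructor => -[b|] ba; [exact: AccS | case: (notF ba)].
Qed.

End ord_succ_order.

(* The interval [1, omega ^ xi] is the set of nonzero elements of the ordinal
   omega ^ xi + 1 = [0, omega ^ xi]. *)
Definition omega_itv d (X : orderType d) : Type :=
  {u : ord_succ (omega_pow X) | (Some (omega_pow0 X) < u :> ord_succ _)%O}.

Section omega_itv.
Context d (X : orderType d).
HB.instance Definition _ := SubChoice.on (omega_itv X).
HB.instance Definition _ :=
  [SubChoice_isSubOrder of omega_itv X by <: with d].
End omega_itv.

Definition homeomorphic (S T : topologicalType) : Prop :=
  exists (f : S -> T) (g : T -> S),
    [/\ continuous f, continuous g, cancel f g & cancel g f].

Lemma omega_itv_wf d (X : orderType d) : wellorder X -> wellorder (omega_itv X).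
Proof.
move=> wfX u.
have := ord_succ_wf (omega_pow_wf wfX) (val u).
move Ev : (val u) => v Av; elim: Av u Ev => {}v _ IH u Ev.
by constructor => w wu; apply: (IH (val w)) => //; rewrite -Ev.
Qed.

Lemma wellorder_compact d (T : orderType d) (top : T) :
  wellorder T -> (forall x : T, (x <= top)%O) ->
  compact [set: order_topology T].
Proof.
move=> wfT letop; rewrite compact_ultra => F UF FT.
pose P := [set a : T | F [set x : order_topology T | (x <= a)%O]].
have [a [Pa mina]] : exists a, P a /\ forall b, P b -> (a <= b)%O.
  have : P top by apply: filterS FT => x _; exact: letop.
  move: {1}top => t; elim/(well_founded_ind wfT): t => t IH Pt.
  have [[b [Pb bt]]|/forallNP noP] := pselect (exists b, P b /\ (b < t)%O).
    exact: IH bt Pb.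
  exists t; split => // b Pb; rewrite leNgt; apply/negP => bt.
  by apply: (noP b).
exists a; split => // U; rewrite itv_nbhsE => -[i [oi ai] iU].
have up l : (l < a)%O -> F [set x : order_topology T | (l < x)%O].
  move=> la.
  have [Pl|] := in_ultra_setVsetC [set x : order_topology T | (x <= l)%O] UF.
    by have := mina _ Pl; rewrite leNgt la.
  by apply: filterS => x /negP; rewrite -ltNge.
have down r : (a < r)%O -> F [set x : order_topology T | (x < r)%O].
  by move=> ar; apply: filterS Pa => x /= xa; exact: le_lt_trans ar.
apply: filterS iU _.
case: i oi ai => [[[]l|[]] [[]r|[]]] //= _; rewrite ?in_itv /= ?andbT.
- case/andP=> la ar; apply: filterS2 (up _ la) (down _ ar) => x /= lx xr.
  by rewrite ?in_itv /= ?in_itv /= lx xr.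
- by move=> la; apply: filterS (up _ la) => x /= lx; rewrite ?in_itv /= lx.
- by move=> ar; apply: filterS (down _ ar) => x /= xr; rewrite ?in_itv /=.
- by move=> _; apply: filterS Pa => x _; rewrite ?in_itv.
Qed.

(* In particular the compactness of a space homeomorphic to [1, omega ^ xi] is
   automatic. *)
Lemma omega_itv_compact d (X : orderType d) : wellorder X ->
  compact [set: order_topology (omega_itv X)].
Proof.
move=> wfX.
pose top : omega_itv X := exist _ None isT.
apply: (@wellorder_compact _ _ top); first exact: omega_itv_wf.
by move=> [[u|] u0]; rewrite leEsub.
Qed.

(** * The Cantor-Bendixson derivatives *)

Section cantor_bendixson.
Context (T : topologicalType).

Definition derived (A : set T) : set T := A `&` limit_point A.

Context d (X : orderType d) (wfX : wellorder X) (A : set T).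

(* The derivatives A^(x) for x < xi, through the formula
   A^(x) = A `&` \bigcap_(y < x) (A^(y))', which covers the zero, successor and
   limit cases at once. *)
Definition cb_below : X -> set T :=
  Fix wfX (fun _ => set T) (fun x rec =>
    A `&` [set p | forall y (yx : (y < x)%O), derived (rec y yx) p]).

(* The derivative A^(xi), where xi is the order type of X. *)
Definition cb_derivative : set T :=
  A `&` \bigcap_(x in [set: X]) derived (cb_below x).

Lemma cb_belowE x :
  cb_below x = A `&` \bigcap_(y in [set y | (y < x)%O]) derived (cb_below y).
Proof.
rewrite {1}/cb_below Fix_eq //.
move=> {}x f g fg; congr (_ `&` _); apply/seteqP; split => p /= H y yx.
  by rewrite -fg; exact: H.
by rewrite fg; exact: H.
Qed.

End cantor_bendixson.

Section cantor_bendixson_cases.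
Context (T : topologicalType) d (X : orderType d) (wfX : wellorder X).
Variable A : set T.
Local Notation cb := (cb_below wfX A).

Lemma derivedS (B C : set T) : B `<=` C -> derived B `<=` derived C.
Proof.
move=> BC p [Bp lB]; split; first exact: BC.
by move=> U /lB[y [yp By Uy]]; exists y; split => //; exact: BC.
Qed.

Lemma cb_below_anti x y : (x <= y)%O -> cb y `<=` cb x.
Proof.
move=> xy; rewrite !cb_belowE => p [Ap H]; split=> // z zx.
by apply: H; exact: lt_le_trans xy.
Qed.

Lemma cb_below_zero x : (forall y, ~~ (y < x)%O) -> cb x = A.
Proof.
move=> x0; rewrite cb_belowE; apply/seteqP; split=> [p []//|p Ap].
by split=> // y; have /negP := x0 y.
Qed.

Lemma cb_below_succ x y : (forall z, (z < y)%O = (z <= x)%O) ->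
  cb y = derived (cb x).
Proof.
move=> yx; rewrite [LHS]cb_belowE; apply/seteqP; split=> p.
  by move=> [_]; apply; rewrite /= yx.
move=> dp; split=> [|z /=].
  by case: dp; rewrite cb_belowE => -[].
by rewrite yx => zx; apply: derivedS dp; exact: cb_below_anti.
Qed.

Lemma cb_below_limit x : (exists y, (y < x)%O) ->
    (forall y, (y < x)%O -> exists z, (y < z < x)%O) ->
  cb x = \bigcap_(y in [set y | (y < x)%O]) cb y.
Proof.
move=> [y0 y0x] lim; apply/seteqP; split=> [p cp y /= yx|p H].
  by apply: cb_below_anti cp; exact: ltW.
rewrite cb_belowE; split; first by have := H _ y0x; rewrite cb_belowE => -[].
move=> y /= /lim[z /andP[yz zx]]; have := H _ zx.
by rewrite [X in X p -> _]cb_belowE => -[_]; exact.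
Qed.

End cantor_bendixson_cases.

(** * Families of finite sets of natural numbers *)

Section families.
Local Open Scope fset_scope.
Implicit Types F : set {fset nat}.

Definition indicator (A : {fset nat}) : cantor_space := fun n => n \in A.

Definition hereditary F : Prop := forall A B, A `<=` B -> F B -> F A.

Definition spreading F : Prop := forall s t : seq nat,
  sorted ltn s -> sorted ltn t -> all2 leq s t ->
  F [fset n in s] -> F [fset n in t].

Definition compact_family F : Prop := compact (indicator @` F)%classic.

Definition regular_family F : Prop :=
  [/\ hereditary F, spreading F, compact_family F & forall n, F [fset n]].

Definition family_of_order d (X : orderType d) (wfX : wellorder X) F : Prop :=
  cb_derivative wfX (indicator @` F)%classic = [set indicator fset0]%classic.

End families.

(** * The Banach space C(K) *)

(* Real-valued continuous functions on the compact space K; the proof cK is what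
   makes the supremum norm below a norm. *)
Definition Cspace (R : realType) (K : topologicalType)
  (cK : compact [set: K]) : Type := continuousType K R.

Section Cspace.
Context (R : realType) (K : topologicalType) (cK : compact [set: K]).
Local Notation C := (Cspace R cK).

HB.instance Definition _ := Choice.on C.

Lemma Cspace_continuous (f : C) : continuous f.
Proof. exact: cts_fun. Qed.

Lemma CspaceP (f g : C) : f =1 g -> f = g.
Proof. by move/continuousEP. Qed.

Definition mkC (f : K -> R) (cf : continuous f) : C :=
  (mkcts cf : continuousType K R).

Let zero_cts : continuous (fun _ : K => 0 : R).
Proof. exact: cst_continuous. Qed.
Let opp_cts (f : C) : continuous (fun x => - f x).
Proof. by move=> x; apply: continuousN; exact: Cspace_continuous. Qed.
Let add_cts (f g : C) : continuous (fun x => f x + g x).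
Proof. by move=> x; apply: continuousD; exact: Cspace_continuous. Qed.
Let scale_cts a (f : C) : continuous (fun x => a * f x).
Proof.
by move=> x; apply: continuousM; [exact: cst_continuous | exact: Cspace_continuous].
Qed.

Definition C0 : C := mkC zero_cts.
Definition Copp (f : C) : C := mkC (@opp_cts f).
Definition Cadd (f g : C) : C := mkC (@add_cts f g).
Definition Cscale (a : R) (f : C) : C := mkC (@scale_cts a f).

Let CaddA : associative Cadd.
Proof. by move=> f g h; apply: CspaceP => x; exact: addrA. Qed.
Let CaddC : commutative Cadd.
Proof. by move=> f g; apply: CspaceP => x; exact: addrC. Qed.
Let Cadd0 : left_id C0 Cadd.
Proof. by move=> f; apply: CspaceP => x; exact: add0r. Qed.
Let CaddN : left_inverse C0 Copp Cadd.
Proof. by move=> f; apply: CspaceP => x; exact: addNr. Qed.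

HB.instance Definition _ := GRing.isZmodule.Build C CaddA CaddC Cadd0 CaddN.

Let CscaleA a b (f : C) : Cscale a (Cscale b f) = Cscale (a * b) f.
Proof. by apply: CspaceP => x; exact: mulrA. Qed.
Let Cscale1 : left_id 1 Cscale.
Proof. by move=> f; apply: CspaceP => x; exact: mul1r. Qed.
Let CscaleDr : right_distributive Cscale +%R.
Proof. by move=> a f g; apply: CspaceP => x; exact: mulrDr. Qed.
Let CscaleDl (f : C) : {morph Cscale^~ f : a b / a + b}.
Proof. by move=> a b; apply: CspaceP => x; exact: mulrDl. Qed.

HB.instance Definition _ :=
  GRing.Zmodule_isLmodule.Build R C CscaleA Cscale1 CscaleDr CscaleDl.

Lemma CaddE (f g : C) x : (f + g) x = f x + g x. Proof. by []. Qed.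
Lemma CoppE (f : C) x : (- f) x = - f x. Proof. by []. Qed.
Lemma CscaleE a (f : C) x : (a *: f) x = a * f x. Proof. by []. Qed.

Definition Cnorm (f : C) : R := sup [set `|f x| | x in [set: K]].

Lemma Cnorm_has_ubound (f : C) : has_ubound [set `|f x| | x in [set: K]].
Proof.
have /compact_bounded : compact (f @` [set: K]).
  by apply: continuous_compact => //; apply: continuous_subspaceT;
    exact: Cspace_continuous.
rewrite /bounded_set /bounded_near => /pinfty_ex_gt0[M _ fM].
by exists M => _ [x _ <-]; apply: fM; exists x.
Qed.

Lemma Cnorm_ge (f : C) x : `|f x| <= Cnorm f.
Proof. by apply: ub_le_sup; [exact: Cnorm_has_ubound | exists x]. Qed.

Lemma Cnorm_ge0 (f : C) : 0 <= Cnorm f.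
Proof.
have [f0|/set0P[_ [x _ _]]] := eqVneq [set `|f x| | x in [set: K]] set0.
  by rewrite /Cnorm f0 sup0.
exact: le_trans (Cnorm_ge f x).
Qed.

Lemma Cnorm_le (f : C) M : 0 <= M -> (forall x, `|f x| <= M) -> Cnorm f <= M.
Proof.
move=> M0 fM; rewrite /Cnorm.
have [->|/set0P f0] := eqVneq [set `|f x| | x in [set: K]] set0.
  by rewrite sup0.
by apply: sup_le_ub => // _ [x _ <-].
Qed.

Let CnormD (f g : C) : Cnorm (f + g) <= Cnorm f + Cnorm g.
Proof.
apply: Cnorm_le => [|x]; first by rewrite addr_ge0 ?Cnorm_ge0.
by rewrite CaddE (le_trans (ler_normD _ _)) // lerD ?Cnorm_ge.
Qed.

Let CnormZ a (f : C) : Cnorm (a *: f) = `|a| * Cnorm f.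
Proof.
have le b (g : C) : Cnorm (b *: g) <= `|b| * Cnorm g.
  apply: Cnorm_le => [|x]; first by rewrite mulr_ge0 ?Cnorm_ge0.
  by rewrite CscaleE normrM ler_wpM2l ?Cnorm_ge.
apply/eqP; rewrite eq_le le /=.
have [->|a0] := eqVneq a 0; first by rewrite normr0 mul0r Cnorm_ge0.
have := le a^-1 (a *: f).
by rewrite scalerA mulVf // scale1r normfV ler_pdivlMl ?normr_gt0.
Qed.

Let Cnorm0_eq0 (f : C) : Cnorm f = 0 -> f = 0.
Proof.
move=> f0; apply: CspaceP => x; apply/eqP.
by have := Cnorm_ge f x; rewrite f0 normr_le0.
Qed.

HB.instance Definition _ := Lmodule_isNormed.Build R C CnormD CnormZ Cnorm0_eq0.

Lemma CnormE (f : C) : `|f| = sup [set `|f x| | x in [set: K]].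
Proof. by []. Qed.

Let Ccomplete (F : set_system C) : ProperFilter F -> cauchy F -> cvg F.
Proof.
move=> FF /cauchy_ballP Fc.
have Fx x : cvg ((fun f : C => f x) @ F).
  apply: cauchy_cvg; apply/cauchy_ballP => e e0.
  have := Fc e e0; rewrite !near_simpl => H.
  near_simpl; apply: filterS H => -[f g] /=.
  rewrite -!ball_normE /= => fg; apply: le_lt_trans fg.
  by have := Cnorm_ge (f - g) x; rewrite CaddE CoppE.
pose l (x : K) : R := lim ((fun f : C => f x) @ F).
have unif (e : R) : 0 < e -> F [set f : C | forall x, `|l x - f x| <= e].
  move=> e0; have := Fc e e0; rewrite near_simpl => H.
  have [P [Q [FP FQ PQ]]] : exists P Q, [/\ F P, F Q &
      forall f g, P f -> Q g -> ball f e g].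
    by case: H => -[P Q] /= [FP FQ] PQ; exists P, Q; split=> // f g Pf Qg;
      exact: (PQ (f, g)).
  apply: filterS FQ => g Qg x.
  have cl : (fun f : C => f x - g x) @ F --> l x - g x.
    by apply: cvgB; [exact: Fx | exact: cvg_cst].
  apply: (cvgr_to_le (cvg_norm cl)).
  apply: filterS FP => f Pf.
  have := PQ f g Pf Qg; rewrite -ball_normE /= => /ltW; apply: le_trans.
  by have := Cnorm_ge (f - g) x; rewrite CaddE CoppE.
have cl : continuous l.
  move=> x; apply/cvgrPdist_le => e e0.
  have [g gl] : exists g : C, forall x, `|l x - g x| <= e / 3.
    by apply: (@filter_ex _ F); apply: unif; rewrite divr_gt0.
  have /cvgrPdist_le/(_ (e / 3)) := @Cspace_continuous g x.
  move=> /(_ (divr_gt0 e0 (ltr0n _ 3))); apply: filterS => y gxy.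
  rewrite (_ : l x - l y = (l x - g x) + (g x - g y) - (l y - g y)); last by ring.
  rewrite (le_trans (ler_normB _ _)) //.
  rewrite (le_trans (lerD (ler_normD _ _) (lexx _))) //.
  have := gl x; have := gl y; move: gxy; lra.
apply/cvg_ex; exists (mkC cl); apply/cvgrPdist_le => e e0.
apply: filterS (unif e e0) => f fl.
by apply: Cnorm_le => [|x]; [exact: ltW | exact: fl].
Qed.

HB.instance Definition _ := Uniform_isComplete.Build C Ccomplete.

End Cspace.

(** * Sequences in Banach spaces *)

Section sequences.
Context (R : realType) (V : completeNormedModType R).
Implicit Types (x : nat -> V) (F : set {fset nat}).

Definition normalized x : Prop := forall n, `|x n| = 1.

Definition weakly_null x : Prop := forall phi : {linear V -> R^o},
  continuous phi -> phi (x n) @[n --> \oo] --> (0 : R^o).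

(* Finitely supported scalar sequences are finitely supported functions. *)
Definition lin_comb x (a : {fsfun nat -> R with 0}) : V :=
  \sum_(n <- finsupp a) a n *: x n.

(* (x n) is a Schauder basis of its closed linear span. *)
Definition basic_sequence x : Prop := forall v : V,
  closure (range (lin_comb x)) v ->
  exists! a : nat -> R, series (fun n => a n *: x n) @ \oo --> v.

Definition F_unconditional F x : Prop :=
  [/\ normalized x, basic_sequence x &
    exists2 c : R, 0 < c & forall (A : {fset nat}) (a : {fsfun nat -> R with 0}),
      F A -> `|\sum_(n <- A) a n *: x n| <= c * `|lin_comb x a| ].

(* Unconditionality is the case where F consists of all finite sets. *)
Definition unconditional x : Prop := F_unconditional [set: {fset nat}] x.

End sequences.

(* Main.v *)
Require Import Defs.
From HB Require Import structures.
From mathcomp Require Import all_boot all_order all_algebra finmap ring lra zify.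
From mathcomp Require Import all_classical all_reals all_analysis.

Import Order.TTheory GRing.Theory Num.Theory.
Import numFieldNormedType.Exports.

Set Implicit Arguments.
Unset Strict Implicit.
Unset Printing Implicit Defensive.

Local Open Scope classical_set_scope.
Local Open Scope ring_scope.

(** Since K is countable, a diagonal subsequence satisfies |f_k(t)| < 2^-k for
   all large k, at every point t; put D t = {k : 2^-k <= |f_k(t)|}.  It is enough
   to find an infinite M such that D t `&` M, deprived of its least element, lies
   in F for all t: in the sum of a_n f_n(t) over a finite subset of M, the terms
   outside D t add up to at most 2 max |a_n|, the least element of D t costs
   another max |a_n|, and the rest is handled by F-unconditionality.

   M is built by induction on the Cantor-Bendixson rank y of t, locally on a
   left interval (a, t] in which the other points have rank below y, and for the
   families {B : A `|` B in F} with A in F^(y).  Pick m outside D t; then m lies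
   outside D s for s in some (b, t].  The remaining points of (a, b] are covered
   by finitely many intervals (a', t'] with t' of rank z < y.  For each of them A
   is a limit of sets A' in F^(z), and the induction hypothesis at A' produces N
   such that, for every s in (a', t'], A' joined with D s `&` N minus its least
   element is in F; spreading a point of A' above A to that least element puts
   A joined with D s `&` N in F.  This allows for the extra point m,
   and iterating the choice of m diagonally gives M.  The least element has to be
   given away because b, hence the ranks z, are only known after m. *)

(** * Infinite sets of natural numbers and diagonalization *)

Definition unbounded (M : set nat) : Prop :=
  forall n, exists2 m, M m & (n < m)%N.

Lemma unbounded_above (M : set nat) n :
  unbounded M -> unbounded (M `&` [set i | (n < i)%N]).
Proof.
move=> uM k; have [m Mm km] := uM (maxn n k).
by exists m; [split=> //=|]; move: km; rewrite gtn_max => /andP[].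
Qed.

(** Iterating the step yields points m_0 < m_1 < ... and decreasing sets N_k with [P m_k N_k]; all
    later points lie in N_k, and P passes to subsets. *)
Lemma unbounded_diagonal (P : nat -> set nat -> Prop) :
  (forall m (N N' : set nat), N' `<=` N -> P m N -> P m N') ->
  (forall N, unbounded N -> exists m (N' : set nat),
    [/\ N m, unbounded N', N' `<=` N, forall i, N' i -> (m < i)%N & P m N']) ->
  forall N, unbounded N -> exists M : set nat,
    [/\ unbounded M, M `<=` N &
        forall m, M m -> P m (M `&` [set i | (m < i)%N])].
Proof.
move=> Panti Pstep N0 uN0.
have /choice[step stepP] (N : {N | unbounded N}) :
    exists q : nat * {N | unbounded N}, [/\ sval N q.1, sval q.2 `<=` sval N,
      forall i, sval q.2 i -> (q.1 < i)%N & P q.1 (sval q.2)].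
  case: N => N uN; have [m [N' [Nm uN' sN' mN' PmN']]] := Pstep N uN.
  by exists (m, exist _ N' uN').
pose S k := iter k (fun N => (step N).2) (exist _ N0 uN0).
pose m k := (step (S k)).1.
have Ssub j k : (j <= k)%N -> sval (S k) `<=` sval (S j).
  move=> /subnK <-; elim: (k - j)%N => // l IH; rewrite addSn => i.
  by have [_ H _ _] := stepP (S (l + j)%N); move/H/IH.
have mS k : sval (S k) (m k) by have [] := stepP (S k).
have mlt j k : (j < k)%N -> (m j < m k)%N.
  move=> jk; have [_ _ H _] := stepP (S j); apply: H.
  exact: (Ssub j.+1 k jk).
have mge k : (k <= m k)%N.
  by elim: k => // k IH; exact: leq_ltn_trans IH (mlt _ _ _).
exists (range m); split.
- by move=> n; exists (m n.+1); [exists n.+1|exact: mge].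
- by move=> _ [k _ <-]; exact: (Ssub 0%N k).
- move=> _ [k _ <-]; have [_ _ _ H] := stepP (S k); apply: Panti H.
  move=> _ [[j _ <-]] /= kj.
  suff jk : (k < j)%N by exact: (Ssub k.+1 j jk).
  rewrite ltnNge leq_eqVlt; apply/negP => /orP[/eqP jk|/mlt jk].
    by rewrite jk ltnn in kj.
  by move: kj; rewrite ltnNge (ltnW jk).
Qed.

Lemma unbounded_enum (M : set nat) : unbounded M ->
  exists psi : nat -> nat,
    (forall i j, (i < j)%N -> (psi i < psi j)%N) /\ forall i, M (psi i).
Proof.
move=> uM.
have /choice[g gP] n : exists m, M m /\ (n < m)%N.
  by have [m] := uM n; exists m.
(* The exponent [i.+1] discards the start 0, which may lie outside M. *)
pose psi i := iter i.+1 g 0%N; exists psi; split.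
  by apply: homo_ltn ltn_trans _ => i; exact: (gP _).2.
by move=> i; exact: (gP _).1.
Qed.

Lemma increasing_ge (phi : nat -> nat) :
  (forall i j, (i < j)%N -> (phi i < phi j)%N) -> forall i, (i <= phi i)%N.
Proof. by move=> lt; elim=> // i IH; exact: leq_ltn_trans IH (lt _ _ _). Qed.

Lemma increasing_inj (phi : nat -> nat) :
  (forall i j, (i < j)%N -> (phi i < phi j)%N) -> injective phi.
Proof.
by move=> lt i j ij; have [/lt|/lt|//] := ltngtP i j; rewrite ij ltnn.
Qed.

Lemma fset_nat_ub (A : {fset nat}) : exists N, forall i, i \in A -> (i < N)%N.
Proof.
by exists (\max_(i <- A) i).+1 => i iA; rewrite ltnS; exact: leq_bigmax_seq.
Qed.

Lemma fset_nat_min (A : {fset nat}) : A <> fset0 ->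
  exists2 m, m \in A & forall i, i \in A -> (m <= i)%N.
Proof.
move=> A0; have exA : exists i, i \in A.
  by have [//|[i iA]] := fset_0Vmem A; exists i.
by exists (ex_minn exA); case: ex_minnP.
Qed.

(** * Moving sets inside a spreading family *)

Section families.
Local Open Scope fset_scope.

Lemma spreading_map (F : set {fset nat}) (B : {fset nat}) (g : nat -> nat) :
  spreading F -> (forall i, i \in B -> (i <= g i)%N) ->
  (forall i j, i \in B -> j \in B -> (i < j)%N -> (g i < g j)%N) ->
  F B -> F [fset g i | i in B].
Proof.
move=> spF ge lt FB; pose s := sort leq B.
have sB i : (i \in s) = (i \in B) by rewrite mem_sort.
have ss : sorted ltn s.
  rewrite ltn_sorted_uniq_leq sort_uniq fset_uniq /=.
  by apply: sort_sorted; exact: leq_total.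
have -> : [fset g i | i in B] = [fset n in map g s].
  apply/fsetP => j; rewrite !inE; apply/imfsetP/mapP => /=.
    by move=> [i iB ->]; exists i; rewrite ?sB.
  by move=> [i iB ->]; exists i; rewrite -?sB.
apply: (spF s) => //.
- apply: (homo_sorted_in (P := mem B) (e := ltn)) ss => //.
  by apply/allP => i; rewrite sB.
- have : all (mem B) s by apply/allP => i; rewrite sB.
  elim: (s) => //= i r IH /andP[iB rB]; rewrite ge //=; exact: IH.
- suff <- : B = [fset n in s] by [].
  by apply/fsetP => i; rewrite !inE sB.
Qed.

(** No element of C lies in [n, m], so raising n to m keeps the order of the elements. *)
Lemma spreading_shift (F : set {fset nat}) (C : {fset nat}) n m :
  spreading F -> (n <= m)%N ->
  (forall c, c \in C -> (c < n)%N \/ (m < c)%N) ->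
  F (n |` C) -> F (m |` C).
Proof.
move=> spF nm Cnm.
pose g i := if i == n then m else i.
move=> /(@spreading_map _ _ g spF) H.
have -> : m |` C = [fset g i | i in n |` C].
  apply/fsetP => j; apply/fset1UP/imfsetP => /=.
    move=> [->|jC]; first by exists n; rewrite ?inE ?eqxx // /g eqxx.
    exists j; rewrite ?inE ?jC ?orbT // /g; case: eqP => // jn.
    by have := Cnm _ jC; rewrite jn; lia.
  move=> [i]; rewrite !inE /g => /orP[/eqP ->|iC ->].
    by rewrite eqxx => ->; left.
  by case: eqP => _; [left|right].
apply: H => [i|i j]; rewrite !inE /g.
  by case: eqP => [->|].
move=> /orP[/eqP ->|iC] /orP[/eqP ->|jC]; rewrite ?eqxx ?ltnn //.
- by have := Cnm _ jC; case: eqP; lia.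
- by have := Cnm _ iC; case: eqP; lia.
- by have := Cnm _ iC; have := Cnm _ jC; do 2 case: eqP; lia.
Qed.

End families.

(** * Limit points in Cantor space *)

Lemma cantor_nbhs_prefix (u : cantor_space) N :
  nbhs u [set v : cantor_space | forall i, (i < N)%N -> v i = u i].
Proof.
elim: N => [|N IH]; first by apply: filterS filterT.
have : nbhs u [set v : cantor_space | v N = u N].
  have /(_ [set u N]) := @proj_continuous nat (fun=> bool) N u.
  by apply; exact: discrete_set1.
apply: filterS2 IH => v vi vN i; rewrite ltnS leq_eqVlt => /orP[/eqP ->//|].
exact: vi.
Qed.

Lemma derived_indicator (E : set cantor_space) (F : set {fset nat})
    (A : {fset nat}) N :
  E `<=` indicator @` F -> derived E (indicator A) ->
  exists A' : {fset nat}, [/\ E (indicator A'), A' != A &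
    forall i, (i < N)%N -> (i \in A') = (i \in A)].
Proof.
move=> EF [_ /(_ _ (cantor_nbhs_prefix (indicator A) N))[u [uA Eu ui]]].
have [A' _ A'u] := EF _ Eu; exists A'; rewrite A'u; split=> //.
  by apply: contra_neq uA => <-; rewrite A'u.
by move=> i iN; have := ui i iN; rewrite -A'u.
Qed.

(** * Ranks of ordinals up to omega^xi *)

Section rank.
Context d (X : orderType d).
Hypothesis wfX : wellorder X.
Local Notation S := (ord_succ (omega_pow X)).
Local Notation T := (omega_itv X).

(* The Cantor-Bendixson rank of a nonzero ordinal is the least exponent of its
   Cantor normal form; None is the exponent xi, the rank of omega ^ xi. *)
Definition cb_rank (u : S) (y : ord_succ X) : Prop :=
  match u, y with
  | Some f, Some x => f x != 0%N /\ forall z, (z < x)%O -> f z = 0%N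
  | None, None => True
  | _, _ => False
  end.

Lemma cb_rank_ex (u : S) :
  (Some (omega_pow0 X) < u :> S)%O -> exists y, cb_rank u y.
Proof.
case: u => [f|_]; last by exists None.
move=> /(omega_pow_ltP (omega_pow0 X) f)[x [fx _]].
have {fx} : f x != 0%N by rewrite -lt0n; apply: leq_ltn_trans fx.
elim/(well_founded_ind wfX): x => x IH fx.
have [[z [zx fz]]|/forallNP nz] :=
  pselect (exists z, (z < x)%O /\ f z != 0%N).
  exact: IH zx fz.
exists (Some x); split=> // z zx; apply/eqP/negPn/negP => fz.
exact: (nz z).
Qed.

(** The endpoint a lowers the last coefficient of the Cantor normal form of u by one: a point
    strictly between a and u is a plus terms of exponents below y, the least of which is its rank.
    For u = omega^xi, a is 0. *)
Lemma cb_rank_isolated (u : S) (y : ord_succ X) :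
  (Some (omega_pow0 X) < u :> S)%O -> cb_rank u y ->
  exists2 a : S, (a < u)%O &
    forall v z, (a < v < u)%O -> cb_rank v z -> (z < y)%O.
Proof.
case: u y => [f|] [x|] //= f0; last first.
  move=> _; exists (Some (omega_pow0 X)) => // -[v|] [z|] //= /andP[]//.
move=> [fx fz].
pose a : omega_pow X :=
  [fsfun z in finsupp f => if z == x then (f x).-1 else f z].
have aE z : a z = if z == x then (f x).-1 else f z.
  rewrite fsfunE; case: ifP => // /negbT; rewrite memNfinsupp => /eqP fz0.
  by case: eqP => [zx|_]; rewrite ?fz0 // -zx fz0.
exists (Some a).
  apply/(omega_pow_ltP a f); exists x; rewrite aE eqxx; split; first by lia.
  by move=> z xz; rewrite aE gt_eqF.
move=> [v|] [z|] //= /andP[]// /(omega_pow_ltP a v)[p [avp avq]].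
move=> /(omega_pow_ltP v f)[q [vfq vfr]] [vz vw].
have xq : (x <= q)%O by rewrite leNgt; apply/negP => /fz fq0; rewrite fq0 in vfq.
have [pq|qp|pq] := ltgtP p q.
- have := avq q pq; rewrite aE; case: eqP => [qx|_ fqv]; last by lia.
  suff : (z < x)%O by [].
  apply: le_lt_trans (_ : (p < x)%O); last by rewrite -qx.
  rewrite leNgt; apply/negP => pz.
  by have := vw _ pz => vp0; rewrite vp0 in avp.
- have := vfr p qp; move: avp; rewrite aE.
  by rewrite gt_eqF ?(le_lt_trans xq) //; lia.
- subst q; move: avp; rewrite aE; case: eqP => [px|_]; last by lia.
  by subst p; lia.
Qed.

(* Reads a neighbourhood of t as a left interval (c, t]; the bound c ranges over
   [0, omega ^ xi] because 1 has no predecessor in omega_itv. *)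
Lemma omega_itv_nbhs (t : order_topology T) (U : set (order_topology T)) :
  nbhs t U -> exists2 c : S, (c < val (t : T))%O &
    forall s : T, (c < val s)%O -> (val s <= val (t : T))%O -> U s.
Proof.
rewrite itv_nbhsE => -[i [oi ti] iU].
have tl (s : T) r : (t < r)%O -> (val s <= val (t : T))%O -> (s < r)%O.
  by move=> tr st; apply: le_lt_trans tr.
case: i oi ti iU => [[[]l|[]] [[]r|[]]] //= _; rewrite in_itv /= ?andbT.
- move=> /andP[lt tr] iU; exists (val (l : T)) => // s ls st.
  by apply: iU; rewrite /= in_itv /= (tl s r tr st) andbT.
- move=> lt iU; exists (val (l : T)) => // s ls st.
  by apply: iU; rewrite /= in_itv /= andbT.
- move=> tr iU; exists (Some (omega_pow0 X)); first exact: (valP (t : T)).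
  by move=> s ls st; apply: iU; rewrite /= in_itv /= tl.
- move=> _ iU; exists (Some (omega_pow0 X)); first exact: (valP (t : T)).
  by move=> s ls st; apply: iU; rewrite /= in_itv.
Qed.

Lemma omega_itv_countable : countable [set: X] -> countable [set: T].
Proof.
move=> /countable_injP[e einj].
pose code (f : omega_pow X) : seq (nat * nat) :=
  [seq (e x, f x) | x <- finsupp f].
have cinj : injective code.
  have sub (f g : omega_pow X) : code f = code g ->
      forall x, f x != 0%N -> f x = g x.
    move=> fg x fx.
    have : (e x, f x) \in code f by apply: map_f; rewrite mem_finsupp.
    rewrite fg => /mapP[z _ [ez ->]]; congr (g _).
    by apply: einj => //; rewrite inE.
  move=> f g fg; apply/fsfunP => x.
  have [fx|fx] := eqVneq (f x) 0%N; last exact: sub.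
  have [gx|gx] := eqVneq (g x) 0%N; first by rewrite fx gx.
  by rewrite (sub _ _ (esym fg)).
apply/countable_injP.
exists (fun t : T => choice.pickle (omap code (val t))) => s t _ _.
move=> /(pcan_inj choice.pickleK) st; apply: val_inj; move: st.
by case: (val s) (val t) => [f|] [g|] //= [/cinj ->].
Qed.

End rank.

Section cb_upto.
Context (T : topologicalType) d (X : orderType d) (wfX : wellorder X).

(** Indexed like [cb_rank], with [None] for xi, so that derivatives are labelled by the ranks of
    points. *)
Definition cb_upto (A : set T) (y : ord_succ X) : set T :=
  if y is Some x then cb_below wfX A x else cb_derivative wfX A.

Lemma cb_upto_sub A y : cb_upto A y `<=` A.
Proof. by case: y => [x|] p /=; [rewrite cb_belowE|] => -[]. Qed.

Lemma cb_upto_derived A y z : (z < y)%O ->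
  cb_upto A y `<=` derived (cb_upto A z).
Proof.
case: y z => [x|] [w|] //= wx p; last by move=> [_]; exact.
by rewrite [X in X p -> _]cb_belowE => -[_]; exact.
Qed.

End cb_upto.

(** * Selection of M by induction on the rank *)

Section selection.
Context d (X : orderType d) (wfX : wellorder X).
Local Notation S := (ord_succ (omega_pow X)).
Local Notation T := (omega_itv X).
Variables (F : set {fset nat}) (D : T -> set nat).
Hypotheses (herF : hereditary F) (spF : spreading F).
Hypothesis D_bounded : forall s, exists n, forall m, D s m -> (m < n)%N.
Hypothesis D_closed : forall m, closed [set s : order_topology T | D s m].

Local Notation "F ^( y )" := (cb_upto wfX (indicator @` F) y)
  (at level 1, format "F ^( y )").

Lemma indicator_inj : injective indicator.
Proof. by move=> A B AB; apply/fsetP => i; exact: (congr1 (@^~ i) AB). Qed.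

Lemma cb_upto_mem y (A : {fset nat}) : F^(y) (indicator A) -> F A.
Proof. by move/cb_upto_sub => [B FB /indicator_inj <-]. Qed.

(** Here m is the surrendered least element. A is arbitrary because the induction hypothesis is
    applied to sets A' approximating it. *)
Lemma select_near y (t : T) (a : S) (A : {fset nat}) :
  cb_rank (val t) y -> (a < val t)%O ->
  (forall (s : T) z, (a < val s < val t)%O -> cb_rank (val s) z -> (z < y)%O) ->
  F^(y) (indicator A) ->
  forall N, unbounded N -> exists M : set nat, [/\ unbounded M, M `<=` N &
    forall s : T, (a < val s <= val t)%O -> forall m (B : {fset nat}),
      M m -> D s m -> (forall i, i \in B -> [/\ (m < i)%N, M i & D s i]) ->
      F (A `|` B)%fset].
Proof.
elim/(well_founded_ind (ord_succ_wf wfX)): y t a A => y IHy t a A rty at_ az FyA.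
(* Left of t no element is given away. The finite covering is carried out by induction on b: if a'
   isolates the rank of b, then (a, a'] falls to the induction on b and (a', b] to the one on y. *)
have below b : (b < val t)%O -> forall N, unbounded N ->
    exists M : set nat, [/\ unbounded M, M `<=` N &
      forall s : T, (a < val s <= b)%O -> forall B : {fset nat},
        (forall i, i \in B -> M i /\ D s i) -> F (A `|` B)%fset].
  elim/(well_founded_ind (ord_succ_wf (omega_pow_wf wfX))): b => b IHb bt N uN.
  have [ba|ab] := leP b a.
    exists N; split=> // s /andP[as_ sb].
    by have := lt_le_trans as_ (le_trans sb ba); rewrite ltxx.
  have b0 : (Some (omega_pow0 X) < b :> S)%O.
    apply: le_lt_trans ab; rewrite leNgt; apply/negP.
    by case: (a) => // f0 /omega_pow_eq0.
  pose tb : T := exist _ b b0.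
  have [z rbz] := cb_rank_ex wfX b0.
  have zy : (z < y)%O by apply: (az tb) => //=; rewrite ab.
  have [a' a'b a'z] := cb_rank_isolated b0 rbz.
  have [M1 [uM1 M1N M1F]] := IHb _ a'b (lt_trans a'b bt) N uN.
  (* As K bounds A, a set A' agreeing with A below K contains A; being different, it has an element
     n >= K. *)
  have [K AK] := fset_nat_ub A.
  have [A' [zA' A'A A'K]] := derived_indicator K
    (@cb_upto_sub _ _ _ wfX (indicator @` F) z) (cb_upto_derived zy FyA).
  have AA' i : i \in A -> i \in A' by move=> iA; rewrite A'K ?AK.
  have [n nA' Kn] : exists2 n, n \in A' & (K <= n)%N.
    apply: contra_neqP A'A => nK; apply/fsetP => i.
    have [|Ki] := ltnP i K; first exact: A'K.
    apply/idP/idP => [iA'|/AA'//].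
    by case: nK; exists i.
  (* Cutting at K' puts M beyond A', so that any element of M can later replace n. *)
  have [K' A'K'] := fset_nat_ub A'.
  have [M [uM MM1 MF]] := IHy z zy tb a' A' rbz a'b
    (fun s w h => a'z (val s) w h) zA' _
    (unbounded_above K' uM1).
  have A'M i j : M i -> j \in A' -> (j < i)%N.
    by move=> /MM1[_ /= K'i] /A'K' jK'; exact: ltn_trans K'i.
  exists M; split=> // [i /MM1[/M1N]//|s /andP[as_ sb] B BM].
  have [sa'|a's] := leP (val s) a'.
    by apply: (M1F s) => [|i /BM[/MM1[]]//]; rewrite as_ sa'.
  have [->|/eqP/fset_nat_min[m mB mmin]] := eqVneq B fset0.
    by rewrite fsetU0; exact: cb_upto_mem FyA.
  have := MF s _ m (B `\ m)%fset; rewrite a's sb => /(_ isT).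
  move=> /(_ (BM _ mB).1 (BM _ mB).2) FA'B.
  have {}FA'B : F (A' `|` B `\ m)%fset.
    apply: FA'B => i; rewrite !inE => /andP[im iB].
    by have [] := BM _ iB; split=> //; rewrite ltn_neqAle eq_sym im mmin.
  (* The point n of A' moves up to m: A lies below n, the rest of B above m. *)
  have -> : (A `|` B)%fset = (m |` (A `|` B `\ m))%fset.
    apply/fsetP => i; rewrite !inE.
    by have [->|] := eqVneq i m; rewrite ?mB ?orbT.
  apply: (@spreading_shift F _ n m) => //.
  - by apply: ltnW; apply: A'M => //; exact: (BM _ mB).1.
  - move=> c; rewrite !inE => /orP[/AK cK|/andP[cm cB]].
      by left; exact: leq_trans cK Kn.
    by right; rewrite ltn_neqAle eq_sym cm mmin.
  - apply: herF FA'B; apply/fsubsetP => i; rewrite !inE.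
    by move=> /or3P[/eqP ->|/AA' ->|->]; rewrite ?nA' ?orbT.
move=> N uN.
pose P m (N' : set nat) := forall s : T, (a < val s <= val t)%O -> D s m ->
  forall B : {fset nat}, (forall i, i \in B -> N' i /\ D s i) -> F (A `|` B)%fset.
have [|N1 uN1|M [uM MN MP]] := @unbounded_diagonal P _ _ N uN.
- move=> m N1 N2 N21 PmN1 s hs Dsm B BN2; apply: (PmN1 s) => // i /BN2[/N21].
  by [].
(* Since m lies outside D t, the condition [P m] is vacuous on some (c, t]; [below] handles (a,
   c]. *)
- have [n Dn] := D_bounded t; have [m N1m nm] := uN1 n.
  have /omega_itv_nbhs[c ct cD] :
      nbhs (t : order_topology T) [set s : order_topology T | ~ D s m].
    apply: open_nbhs_nbhs; split; last by move=> /= /Dn; rewrite ltnNge ltnW.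
    by rewrite openC; exact: D_closed.
  have [M [uM MN1 MF]] := below c ct N1 uN1.
  exists m, (M `&` [set i | (m < i)%N]); split=> //.
  + exact: unbounded_above.
  + by move=> i [/MN1].
  + by move=> i [].
  + move=> s /andP[as_ st] Dsm B BM; have [sc|cs] := leP (val s) c.
      by apply: (MF s) => [|i /BM[[]]//]; rewrite as_ sc.
    by case: (cD s cs st).
- exists M; split=> // s hs m B Mm Dsm BM.
  by apply: (MP m Mm s) => // i /BM[].
Qed.

Lemma select_family : F^(None) (indicator fset0) ->
  exists2 M : set nat, unbounded M &
    forall (s : T) m (B : {fset nat}), M m -> D s m ->
      (forall i, i \in B -> [/\ (m < i)%N, M i & D s i]) -> F B.
Proof.
move=> F0.
(* With t = omega^xi and a = 0, the interval (a, t] is the whole space. *)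
pose top : T := exist _ None isT.
have uT : unbounded setT by move=> n; exists n.+1.
have [|||M [uM _ MF]] := @select_near None top (Some (omega_pow0 X)) fset0
  _ _ _ F0 setT uT.
- by [].
- by [].
- by move=> [[f|] f0] [z|] //= /andP[].
- exists M => // s m B Mm Dsm BM.
  rewrite -[B]fset0U; apply: (MF s _ m) => //.
  by rewrite (valP s) /=; case: (val s).
Qed.

End selection.

(** * Finite sums and subsequences of basic sequences *)

Lemma sum_fset_nat (V : zmodType) (A : {fset nat}) N (u : nat -> V) :
  (forall i, i \in A -> (i < N)%N) ->
  \sum_(i <- A) u i = \sum_(0 <= i < N | i \in A) u i.
Proof.
move=> AN; rewrite -[RHS]big_filter; apply: perm_big; apply: uniq_perm.
- exact: fset_uniq.
- by rewrite filter_uniq // iota_uniq.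
- move=> i; rewrite mem_filter mem_index_iota /=.
  by apply/idP/andP => [iA|[]//]; rewrite iA AN.
Qed.

Section sequences.
Context (R : realType) (V : completeNormedModType R).
Implicit Types (x : nat -> V) (g : {fsfun nat -> R with 0}).

Lemma lin_comb_sum x g N : (forall i, i \in finsupp g -> (i < N)%N) ->
  lin_comb x g = \sum_(0 <= i < N) g i *: x i.
Proof.
move=> gN; rewrite /lin_comb (sum_fset_nat _ gN) big_mkcond /=.
apply: eq_bigr => i _; case: ifP => // /negbT; rewrite memNfinsupp => /eqP ->.
by rewrite scale0r.
Qed.

Lemma sum_lin_comb x (b : nat -> R) N : exists g,
  lin_comb x g = \sum_(0 <= i < N) b i *: x i /\
  forall n, (n < N)%N -> g n = b n.
Proof.
pose g : {fsfun nat -> R with 0} :=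
  [fsfun n in [fset i in iota 0 N]%fset => b n].
have gE n : (n < N)%N -> g n = b n.
  by move=> nN; rewrite fsfunE !inE mem_iota /= nN.
exists g; split=> //; rewrite (@lin_comb_sum x g N).
  by apply: eq_big_nat => i /= iN; rewrite gE.
move=> i; rewrite mem_finsupp fsfunE !inE mem_iota /= add0n.
by case: ifP => //; rewrite eqxx.
Qed.

Lemma fsfun_extend (chi : nat -> nat) g : injective chi ->
  exists g', [/\ forall i, g' (chi i) = g i,
    forall n, (forall i, chi i <> n) -> g' n = 0 &
    forall x, lin_comb x g' = lin_comb (x \o chi) g].
Proof.
move=> chi_inj.
(* Off the range of chi the chosen b is unconstrained; the support C makes g' vanish there. *)
have /choice[b bP] n : exists r : R, (forall i, chi i = n -> r = g i).
  have [[i in_]|noi] := pselect (exists i, chi i = n).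
    by exists (g i) => j; rewrite -in_ => /chi_inj ->.
  by exists 0 => i in_; case: noi; exists i.
pose C := [fset chi i | i in finsupp g]%fset.
pose g' : {fsfun nat -> R with 0} := [fsfun n in C => b n].
have g'E i : g' (chi i) = g i.
  rewrite fsfunE (bP _ i) //; case: ifP => // /negbT.
  rewrite mem_imfset //= => gi.
  by apply/esym/eqP; rewrite -memNfinsupp.
exists g'; split=> //.
- move=> n nchi; rewrite fsfunE; case: ifP => // /imfsetP[i _ ni].
  by case: (nchi i).
- move=> x; have -> : lin_comb x g' = \sum_(n <- C) g' n *: x n.
    rewrite /lin_comb; congr (\sum_(n <- _) _); congr enum_fset.
    apply/fsetP => n; rewrite mem_finsupp; apply/idP/idP => [|nC].
      by rewrite fsfunE; case: ifP => //; rewrite eqxx.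
    by have /imfsetP[i /= ig ->] := nC; rewrite g'E -mem_finsupp.
  rewrite big_imfset /=; last by move=> i j _ _ /chi_inj.
  by apply: eq_bigr => i _; rewrite g'E.
Qed.

Lemma sum_subsequence (chi : nat -> nat) (u : nat -> V) m :
  (forall i j, (i < j)%N -> (chi i < chi j)%N) ->
  (forall n, (forall i, chi i <> n) -> u n = 0) ->
  \sum_(0 <= i < m) u (chi i) = \sum_(0 <= n < chi m) u n.
Proof.
move=> chi_lt u0; have chi_le i j : (i <= j)%N -> (chi i <= chi j)%N.
  by rewrite leq_eqVlt => /orP[/eqP ->//|/chi_lt/ltnW].
elim: m => [|m IH].
  rewrite big_geq // big_nat big1 // => n /= nchi; apply: u0 => i in_.
  by move: nchi; rewrite -in_ ltnNge chi_le.
rewrite big_nat_recr //= IH.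
rewrite [RHS](big_cat_nat _ (chi_le m m.+1 _)) //=; congr (_ + _).
rewrite big_ltn ?chi_lt // big_nat big1 ?addr0 // => n /andP[mn nm].
apply: u0 => i in_; move: mn nm; rewrite -in_.
have [im|mi] := leqP i m; first by rewrite ltnNge chi_le.
by move=> _; rewrite ltnNge chi_le.
Qed.

Lemma coef_sum x (c : R) (b : nat -> R) N n :
  (forall g n, `|g n| <= c * `|lin_comb x g|) -> (n < N)%N ->
  `|b n| <= c * `|\sum_(0 <= i < N) b i *: x i|.
Proof.
by move=> coef nN; have [g [<- gb]] := sum_lin_comb x b N; rewrite -gb.
Qed.

(** The coordinates are bounded by c times the norm, and the partial sums of the difference of the
    two series tend to 0. *)
Lemma expansion_unique x (c : R) (a b : nat -> R) (v : V) : 0 < c ->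
  (forall g n, `|g n| <= c * `|lin_comb x g|) ->
  series (fun n => a n *: x n) @ \oo --> v ->
  series (fun n => b n *: x n) @ \oo --> v -> a = b.
Proof.
move=> c0 coef av bv; apply/funext => n; apply/eqP.
rewrite -subr_eq0 -normr_le0; apply/ler_addgt0Pl => e e0.
have : (fun N => series (fun n => a n *: x n) N - series (fun n => b n *: x n) N)
    @ \oo --> v - v by exact: cvgB.
move=> /cvgrPdist_lt/(_ (e / c) (divr_gt0 e0 c0))[N0 _ H].
pose N := maxn N0 n.+1.
have {}H : `|v - v - \sum_(0 <= i < N) (a i - b i) *: x i| < e / c.
  have := H N; rewrite /= /N leq_maxl => /(_ isT); rewrite /series /= -/N.
  by under [X in _ -> `|_ - X| < _]eq_bigr do rewrite scalerBl; rewrite sumrB.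
have nN : (n < N)%N by rewrite /N leq_maxr.
apply: le_trans (coef_sum (fun i => a i - b i) coef nN) _.
rewrite addr0 mulrC -ler_pdivlMr //; apply: ltW.
by move: H; rewrite subrr sub0r normrN.
Qed.

(** The vector v has an expansion along x. Its coefficients off the range of chi vanish, as v is a
    limit of combinations lacking them and coordinates are bounded; the partial sums are then read
    along chi. *)
Lemma basic_subsequence x (chi : nat -> nat) (c : R) : 0 < c ->
  (forall g n, `|g n| <= c * `|lin_comb x g|) ->
  (forall i j, (i < j)%N -> (chi i < chi j)%N) ->
  basic_sequence x -> basic_sequence (x \o chi).
Proof.
move=> c0 coef chi_lt bx v clv.
have chi_inj := increasing_inj chi_lt.
have [|a [av _]] := bx v.
  move=> U /clv[_ [[g _ <-] Ug]].
  have [g' [_ _ g'x]] := fsfun_extend g chi_inj.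
  by exists (lin_comb (x \o chi) g); split=> //; exists g'.
have a0 n : (forall i, chi i <> n) -> a n = 0.
  move=> nchi; apply/eqP; rewrite -normr_le0; apply/ler_addgt0Pl => e e0.
  (* Two approximations of v within e' differ by at most 2 e', which c turns into e. *)
  pose e' := e / (2 * c).
  have e'0 : 0 < e' by rewrite divr_gt0 // mulr_gt0.
  have [_ [[g _ <-] /=]] := clv _ (nbhsx_ballx v _ e'0).
  rewrite -ball_normE /=; have [g' [_ g'0 <-]] := fsfun_extend g chi_inj => vg'.
  have [N1 g'N1] := fset_nat_ub (finsupp g').
  have /cvgrPdist_lt/(_ e' e'0)[N0 _ aN0] := av.
  pose N := maxn (maxn N0 N1) n.+1.
  have nN : (n < N)%N by rewrite /N; lia.
  have {}aN0 : `|v - \sum_(0 <= i < N) a i *: x i| < e'.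
    by apply: aN0; rewrite /= /N; lia.
  rewrite (@lin_comb_sum x g' N) in vg'; last by move=> i /g'N1; rewrite /N; lia.
  have := coef_sum (fun i => a i - g' i) coef nN.
  rewrite g'0 // subr0 addr0 => /le_trans; apply.
  under eq_bigr do rewrite scalerBl.
  rewrite sumrB; move: vg' aN0.
  set p := \sum_(_ <= _ < _) _; set q := \sum_(_ <= _ < _) _ => vp vq.
  have pq : `|q - p| <= e' + e'.
    rewrite -(subrKA v) addrC.
    apply: le_trans (ler_normD _ _) _.
    by apply: lerD; rewrite ?(distrC q); exact: ltW.
  apply: le_trans (ler_wpM2l (ltW c0) pq) _.
  by rewrite (_ : c * _ = e) // /e'; field; rewrite gt_eqF.
have aS : series (fun n => (a \o chi) n *: (x \o chi) n) @ \oo --> v.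
  have -> : series (fun n => (a \o chi) n *: (x \o chi) n) =
      (series (fun n => a n *: x n)) \o chi.
    apply/funext => m /=; rewrite /series /=.
    apply: (sum_subsequence (u := fun n => a n *: x n)) => // n /a0 ->.
    by rewrite scale0r.
  apply: cvg_comp av; apply/cvgnyPge => N; exists N => // n /= Nn.
  exact: leq_trans (increasing_ge chi_lt n).
exists (a \o chi); split=> // b bS; apply: (expansion_unique c0 _ aS bS) => g n.
by have [g' [<- _ <-]] := fsfun_extend g chi_inj.
Qed.

End sequences.

(** * Geometric sums and a diagonal subsequence *)

Section sum_pow2.
Context (R : realType).

Lemma sum_pow2_nat N : \sum_(0 <= i < N) (2^-1 : R) ^+ i <= 2.
Proof.
suff -> : \sum_(0 <= i < N) (2^-1 : R) ^+ i = 2 - 2 * (2^-1 : R) ^+ N.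
  by rewrite gerBl mulr_ge0 // exprn_ge0.
elim: N => [|N IH]; first by rewrite big_geq // expr0 mulr1 subrr.
by rewrite big_nat_recr //= IH exprS; field.
Qed.

Lemma sum_pow2_fset (A : {fset nat}) : \sum_(i <- A) (2^-1 : R) ^+ i <= 2.
Proof.
have [N AN] := fset_nat_ub A; rewrite (sum_fset_nat _ AN).
apply: le_trans (sum_pow2_nat N); rewrite big_mkcond /=.
by apply: ler_sum => i _; case: ifP => // _; rewrite exprn_ge0.
Qed.

End sum_pow2.

Lemma pointwise_diagonal (R : realType) (T : choiceType) (g : nat -> T -> R) :
  countable [set: T] -> (forall t, g n t @[n --> \oo] --> 0) ->
  exists phi : nat -> nat, (forall i j, (i < j)%N -> (phi i < phi j)%N) /\
    forall t, exists n, forall k, (n <= k)%N -> `|g (phi k) t| < 2^-1 ^+ k.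
Proof.
move=> /countable_injP[e einj] g0.
have /choice[L LP] (jk : nat * nat) : exists n, forall i t, (n <= i)%N ->
    e t = jk.1 -> `|g i t| < 2^-1 ^+ jk.2.
  have [[t et]|not] := pselect (exists t, e t = jk.1); last first.
    by exists 0%N => i t _ et; case: not; exists t.
  have p0 : (0 : R) < 2^-1 ^+ jk.2 by rewrite exprn_gt0.
  have /cvgrPdist_lt/(_ _ p0)[n _ H] := g0 t; exists n => i s ni.
  rewrite -et => /einj -> //; rewrite ?inE //.
  by have := H i ni; rewrite sub0r normrN.
(* Summing successors makes phi increasing; the last term dominates [L (j, k)] for all j <= k, which
   controls the point t from k = [e t] on. *)
pose phi k := (\sum_(0 <= l < k.+1) (\sum_(0 <= j < l.+1) L (j, l)).+1)%N.
exists phi; split.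
  apply: homo_ltn ltn_trans _ => i.
  by rewrite /phi [ltnRHS]big_nat_recr //= addnS ltnS leq_addr.
move=> t; exists (e t) => k tk; apply: (LP (e t, k)) => //=.
have : (L (e t, k) <= \sum_(0 <= j < k.+1) L (j, k))%N.
  by rewrite (bigD1_seq (e t)) ?iota_uniq ?mem_index_iota //= leq_addr.
by move=> h; rewrite /phi big_nat_recr //=; lia.
Qed.

Lemma contraction_linear_continuous (R : realType) (V : normedModType R)
    (phi : {linear V -> R^o}) :
  (forall u, `|phi u| <= `|u|) -> continuous phi.
Proof.
move=> phi_le u; apply/cvgrPdist_lt => e e0; near=> w.
rewrite -raddfB; apply: le_lt_trans (phi_le _) _.
by near: w; exact: cvgr_dist_lt.
Unshelve. all: by end_near. Qed.

(** * Evaluations and the return to [C(K)] *)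

Section Ceval.
Context (R : realType) (K : topologicalType) (cK : compact [set: K]) (t : K).

Definition Ceval (u : Cspace R cK) : R^o := u t.

Let Ceval_linear : linear Ceval. Proof. by []. Qed.

HB.instance Definition _ :=
  GRing.isLinear.Build R (Cspace R cK) R^o _ Ceval Ceval_linear.

Lemma Ceval_continuous : continuous Ceval.
Proof.
by apply: contraction_linear_continuous => u; exact: (Cnorm_ge u t).
Qed.

Lemma weakly_null_pointwise (f : nat -> Cspace R cK) :
  weakly_null f -> f n t @[n --> \oo] --> (0 : R).
Proof. by move=> /(_ Ceval Ceval_continuous). Qed.

Lemma Csum_eval (A : {fset nat}) (a : nat -> R) (x : nat -> Cspace R cK) :
  (\sum_(n <- A) a n *: x n) t = \sum_(n <- A) a n * x n t.
Proof. exact: (raddf_sum Ceval). Qed.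

End Ceval.

(** Two extractions are composed: phi from pointwise decay, psi enumerating the selected M. The
    selection puts psi(B) in F, and spreading carries it to chi(B) since phi i >= i. *)
Lemma select_subsequence (R : realType) d (X : orderType d) (wfX : wellorder X)
    (g : nat -> omega_itv X -> R) (F : set {fset nat}) :
  countable [set: X] ->
  (forall n, continuous (g n : order_topology (omega_itv X) -> R)) ->
  (forall t, g n t @[n --> \oo] --> 0) ->
  hereditary F -> spreading F ->
  cb_derivative wfX (indicator @` F) (indicator fset0) ->
  exists chi : nat -> nat, (forall i j, (i < j)%N -> (chi i < chi j)%N) /\
    forall t m (B : {fset nat}), 2^-1 ^+ m <= `|g (chi m) t| ->
      (forall i, i \in B -> (m < i)%N /\ 2^-1 ^+ i <= `|g (chi i) t|) ->
      F [fset chi i | i in B]%fset.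
Proof.
move=> cX gc g0 herF spF F0.
have [phi [phi_lt phiP]] := pointwise_diagonal (omega_itv_countable cX) g0.
pose D (s : omega_itv X) := [set k : nat | 2^-1 ^+ k <= `|g (phi k) s|].
have D_bounded s : exists n, forall m, D s m -> (m < n)%N.
  have [n nP] := phiP s; exists n => m Dm; rewrite ltnNge; apply/negP => /nP.
  by rewrite ltNge Dm.
have D_closed m : closed [set s : order_topology (omega_itv X) | D s m].
  pose h (s : order_topology (omega_itv X)) : R := `|g (phi m) s|.
  apply: (@closed_comp _ _ h [set r | 2^-1 ^+ m <= r]); last exact: closed_ge.
  move=> s _; apply: (@continuous_comp _ _ _
    (g (phi m) : order_topology _ -> R) Num.norm); first exact: gc.
  exact: norm_continuous.
have [M uM MF] := select_family (wfX := wfX) herF spF D_bounded D_closed F0.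
have [psi [psi_lt psiM]] := unbounded_enum uM.
exists (phi \o psi); split=> [i j ij|t m B gm gB]; first exact/phi_lt/psi_lt.
(* The selection uses the threshold 2^-(psi i), at most 2^-i because psi i >= i. *)
have pow_le i : (2^-1 : R) ^+ psi i <= 2^-1 ^+ i.
  by rewrite ler_wiXn2l ?increasing_ge // invf_le1 // ler1n.
have -> : [fset (phi \o psi) i | i in B]%fset =
    [fset phi i | i in [fset psi i | i in B]]%fset.
  apply/fsetP => n; apply/imfsetP/imfsetP => /=.
    by move=> [i iB ->]; exists (psi i) => //; apply/imfsetP; exists i.
  by move=> [_ /imfsetP[i iB ->] ->]; exists i.
apply: spreading_map => //.
- by move=> i _; exact: increasing_ge.
- by move=> i j _ _; exact: phi_lt.
apply: (MF t (psi m)) => //; first exact: le_trans (pow_le m) gm.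
move=> _ /imfsetP[i /= /gB[mi gi] ->]; split=> //; first exact: psi_lt.
exact: le_trans (pow_le i) gi.
Qed.

(** At a point t the factor 4 is 2 for the indices with |x_n(t)| < 2^-n, by a geometric series, 1
    for the least remaining index and 1 for the others, covered by the last hypothesis. *)
Lemma unconditional_bound (R : realType) (K : topologicalType)
    (cK : compact [set: K]) (x : nat -> Cspace R cK) (a : nat -> R)
    (b : R) (A : {fset nat}) : 0 <= b ->
  (forall n, `|a n| <= b) -> (forall n, `|x n| <= 1) ->
  (forall t m (B : {fset nat}), 2^-1 ^+ m <= `|x m t| ->
    (forall i, i \in B -> (m < i)%N /\ 2^-1 ^+ i <= `|x i t|) ->
    `|\sum_(n <- B) a n *: x n| <= b) ->
  `|\sum_(n <- A) a n *: x n| <= 4 * b.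
Proof.
move=> b0 ab x1 HB; apply: Cnorm_le => [|t]; first by rewrite mulr_ge0.
rewrite Csum_eval (bigID (fun n => 2^-1 ^+ n <= `|x n t|)) /=.
have small : `|\sum_(n <- A | ~~ (2^-1 ^+ n <= `|x n t|)) a n * x n t| <= 2 * b.
  apply: le_trans (ler_norm_sum _ _ _) _.
  apply: (@le_trans _ _ (\sum_(n <- A) b * 2^-1 ^+ n)); last first.
    by rewrite -mulr_sumr mulrC ler_wpM2r // sum_pow2_fset.
  rewrite big_mkcond /=; apply: ler_sum => n _; case: ifP => [|_].
    by rewrite -ltNge => /ltW xn; rewrite normrM ler_pM.
  by rewrite mulr_ge0 // exprn_ge0.
suff big : `|\sum_(n <- A | 2^-1 ^+ n <= `|x n t|) a n * x n t| <= 2 * b.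
  apply: le_trans (ler_normD _ _) _; move: small big; lra.
pose A1 := [fset n in A | 2^-1 ^+ n <= `|x n t|]%fset.
have -> : \sum_(n <- A | 2^-1 ^+ n <= `|x n t|) a n * x n t =
    \sum_(n <- A1) a n * x n t by rewrite big_fset.
have A1P n : n \in A1 -> 2^-1 ^+ n <= `|x n t| by rewrite !inE => /andP[].
have [->|/eqP/fset_nat_min[m mA mmin]] := eqVneq A1 fset0.
  by rewrite big_seq_fset0 normr0 mulr_ge0.
rewrite (big_fsetD1 m) //=; apply: le_trans (ler_normD _ _) _.
have -> : 2 * b = b + b by rewrite mulrDl !mul1r.
apply: lerD.
  rewrite normrM -[b]mulr1 ler_pM //.
  by apply: le_trans (x1 m); exact: Cnorm_ge.
rewrite -Csum_eval; apply: le_trans (Cnorm_ge _ t) _.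
apply: (HB t m); first exact: A1P.
move=> i; rewrite in_fsetD1 => /andP[im iA]; split; last exact: A1P.
by rewrite ltn_neqAle eq_sym im mmin.
Qed.

Theorem theorem3p7 (R : realType)
  (d : Order.disp_t) (X : orderType d) (wfX : wellorder X)
  (countableX : countable [set: X])
  (K : topologicalType) (cK : compact [set: K])
  (hK : homeomorphic K (order_topology (omega_itv X)))
  (f : nat -> Cspace R cK) (f_norm : normalized f) (f_null : weakly_null f)
  (F : set {fset nat}) (F_regular : regular_family F)
  (F_order : family_of_order wfX F)
  (f_uncond : F_unconditional F f) :
  exists phi : nat -> nat, (forall i j, (i < j)%N -> (phi i < phi j)%N) /\
    unconditional (f \o phi).
Proof.
have [p [q [_ qc pq _]]] := hK.
have [herF spF _ F1] := F_regular.
have [_ f_basic [c c0 cF]] := f_uncond.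
pose g n (s : omega_itv X) : R := f n (q s).
have [|||chi [chi_lt chiF]] :=
  @select_subsequence R d X wfX g F countableX _ _ herF spF.
- move=> n s; apply: (@continuous_comp _ _ _ q (f n)); first exact: qc.
  exact: Cspace_continuous.
- by move=> s; exact: weakly_null_pointwise.
- by have : [set indicator fset0] (indicator fset0) by []; rewrite -F_order.
exists chi; split=> //.
(* Singletons lie in F, so F-unconditionality bounds the coordinates. *)
have coef (b : {fsfun nat -> R with 0}) n : `|b n| <= c * `|lin_comb f b|.
  have := cF [fset n]%fset b (F1 n); rewrite big_seq_fset1 normrZ f_norm.
  by rewrite mulr1.
split; first by move=> n; exact: f_norm.
  exact: basic_subsequence c0 coef chi_lt f_basic.
have chi_inj := increasing_inj chi_lt.
exists (4 * c); first by rewrite mulr_gt0.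
move=> A a _; have [a' [a'E _ a'f]] := fsfun_extend (Cspace R cK) a chi_inj.
rewrite -a'f -mulrA; apply: unconditional_bound.
- by rewrite mulr_ge0 // ltW.
- by move=> n; rewrite -a'E.
- by move=> n; rewrite /= f_norm.
- move=> t m B xm xB.
  have := chiF (p t) m B; rewrite /g pq => /(_ xm xB) FB.
  have := cF _ a' FB; rewrite big_imfset /=; last by move=> i j _ _ /chi_inj.
  by under eq_bigr do rewrite a'E.
Qed.
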